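(* Let $\mathcal{V}=\{1,\dots,N\}$ and let $\{A(t)\}_{t\ge 0}$ ($t$ a non-negative integer) be a chain of $N\times N$ stochastic matrices. If $\{A(t)\}$ is class-ergodic, then for every island $I$ of $\{A(t)\}$, the chain $\{A(t)\}$ has the infinite jet-flow property over $I$.
   Context: Time $t$ is discrete, $t=0,1,2,\dots$. A stochastic matrix is a row-stochastic matrix (non-negative entries, each row sums to $1$); $A(t)=[a_{ij}(t)]$. Class-ergodic: for every $t_0\ge 0$ the product $A(t)A(t-1)\cdots A(t_0)$ converges as $t\to\infty$. Infinite flow graph: the undirected graph on vertex set $\mathcal{V}$ in which distinct $i,j$ are joined iff $\sum_{t=0}^\infty (a_{ij}(t)+a_{ji}(t))=\infty$. The vertex set of each connected component of this graph is called an island of $\{A(t)\}$. Jets: for $\mathcal{V}'\subseteq\mathcal{V}$, a jet $J$ in $\mathcal{V}'$ is a sequence $\{J(t)\}_{t\ge0}$ of subsets of $\mathcal{V}'$; it is proper if $\emptyset\ne J(t)\subsetneq\mathcal{V}'$ for all $t\ge0$. $\mathcal{V}'\backslash J$ denotes the jet $\{\mathcal{V}'\backslash J(t)\}$. For two disjoint jets $J^s,J^k$ (disjoint at each time), $$U(J^s,J^k)=\sum_{t=0}^\infty\Big[\sum_{i\in J^s(t+1)}\sum_{j\in J^k(t)}a_{ij}(t)+\sum_{i\in J^k(t+1)}\sum_{j\in J^s(t)}a_{ij}(t)\Big]\in[0,\infty].$$ The chain has the infinite jet-flow property over $\mathcal{V}'$ if $U(J,\mathcal{V}'\backslash J)=\infty$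 for every proper jet $J$ in $\mathcal{V}'$. *)

(* Defs.v *)
From mathcomp Require Import all_boot all_order all_algebra.
From mathcomp Require Import all_classical all_reals all_analysis.

Set Implicit Arguments.
Unset Strict Implicit.
Unset Printing Implicit Defensive.

Import Order.TTheory GRing.Theory Num.Theory.
Import numFieldNormedType.Exports.

Local Open Scope classical_set_scope.
Local Open Scope ring_scope.

Definition stochastic (R : realType) (N : nat) (M : 'M[R]_N) : Prop :=
  (forall i j, 0 <= M i j) /\ (forall i, \sum_(j < N) M i j = 1).

(* The product A(t) A(t-1) ... A(t0), latest factor on the left; it is the
   identity matrix when t < t0. *)
Definition backward_prod (R : realType) (N : nat) (A : nat -> 'M[R]_N)
    (t0 t : nat) : 'M[R]_N :=
  \big[mulmx/1%:M]_(s <- rev (index_iota t0 t.+1)) A s.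

Definition class_ergodic (R : realType) (N : nat) (A : nat -> 'M[R]_N) : Prop :=
  forall t0 : nat, cvg (backward_prod A t0 t @[t --> \oo]).

Definition infinite_flow (R : realType) (N : nat) (A : nat -> 'M[R]_N) :
    rel 'I_N :=
  fun i j => (i != j) &&
    ((\sum_(0 <= t <oo) (A t i j + A t j i)%:E)%E == +oo%E).

(* Connected components of the symmetric relation [infinite_flow A]. *)
Definition island (R : realType) (N : nat) (A : nat -> 'M[R]_N)
    (I : {set 'I_N}) : Prop :=
  exists i : 'I_N, I = [set j | connect (infinite_flow A) i j]%SET.

Definition jet (N : nat) := nat -> {set 'I_N}.

Definition jet_in (N : nat) (V : {set 'I_N}) (J : jet N) : Prop :=
  forall t : nat, J t \subset V.

Definition proper_jet (N : nat) (V : {set 'I_N}) (J : jet N) : Prop :=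
  forall t : nat, J t <> finset.set0 /\ J t \proper V.

Definition jet_compl (N : nat) (V : {set 'I_N}) (J : jet N) : jet N :=
  fun t => V :\: J t.

(* Meant for jets [Js] and [Jk] that are disjoint at each time. *)
Definition jet_flow (R : realType) (N : nat) (A : nat -> 'M[R]_N)
    (Js Jk : jet N) : \bar R :=
  (\sum_(0 <= t <oo)
     (\sum_(i in Js t.+1) \sum_(j in Jk t) A t i j
      + \sum_(i in Jk t.+1) \sum_(j in Js t) A t i j)%R%:E)%E.

Definition infinite_jet_flow (R : realType) (N : nat) (A : nat -> 'M[R]_N)
    (V : {set 'I_N}) : Prop :=
  forall J : jet N, jet_in V J -> proper_jet V J ->
    jet_flow A J (jet_compl V J) = +oo%E.

(* Main.v *)
Require Import Defs.
From mathcomp Require Import all_boot all_order all_algebra.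
From mathcomp Require Import all_classical all_reals all_analysis.
From mathcomp Require Import lra.

Set Implicit Arguments.
Unset Strict Implicit.
Unset Printing Implicit Defensive.

Import Order.TTheory GRing.Theory Num.Theory.
Import numFieldNormedType.Exports.
Local Open Scope classical_set_scope.
Local Open Scope ring_scope.

(** Suppose that a proper jet [J] in an island [I] has finite flow to its
    complement [I \ J]. Since the flow between [I] and its complement is finite
    as well, the total weight leaking out of [J], and out of [I \ J], over all
    times is finite ([cvg_series_leak]). Run the chain from a late time [T] on the
    indicator of [J T]: the state remains close to [1] on [J t] and close to [0]
    on [I \ J t], with an error at most the leak accumulated since [T]
    ([jet_tracking]). By class-ergodicity the state converges, so an index cannot
    keep switching between the two sides, and [J] is eventually a constant
    set ([jet_eventually_constant]). For constant [J] the leaks dominate the entries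
    between [J] and [I \ J], so these are summable and no edge of the infinite
    flow graph joins [J] to [I \ J] ([infinite_flow_leak]). Both sets being
    nonempty, this contradicts the connectedness of [I]. *)

(** * Series of nonnegative reals *)

Lemma is_cvg_series_nneseries (R : realType) (u : nat -> R) :
  (forall n, 0 <= u n) ->
  (\sum_(0 <= n <oo) (u n)%:E)%E != +oo%E -> cvgn (series u).
Proof.
move=> u0 sumu.
have su : (\sum_(0 <= n <oo) (u n)%:E)%E \is a fin_num.
  rewrite ge0_fin_numE ?ltey//.
  by apply: nneseries_ge0 => n _ _; rewrite lee_fin.
apply: nondecreasing_is_cvgn.
  by apply/nondecreasing_seqP => n; rewrite /series/= big_nat_recr//= lerDl.
exists (fine (\sum_(0 <= n <oo) (u n)%:E)%E) => _ [n _ <-].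
rewrite -lee_fin fineK// /series/= -sumEFin.
by apply: (nneseries_lim_ge (P := xpredT)) => k _ _; rewrite lee_fin.
Qed.

Lemma nneseries_neq_pinfty (R : realType) (u : nat -> R) :
  cvgn (series u) -> (\sum_(0 <= n <oo) (u n)%:E)%E != +oo%E.
Proof.
move=> cu.
have -> : (fun n => (\sum_(0 <= k < n) (u k)%:E)%E) = EFin \o series u.
  by apply/funext => n /=; rewrite sumEFin.
by rewrite EFin_lim.
Qed.

Lemma is_cvg_series_sum (R : realType) (J : Type) (s : seq J) (P : pred J)
    (u : J -> nat -> R) :
  (forall j, P j -> cvgn (series (u j))) ->
  cvgn (series (fun n => \sum_(j <- s | P j) u j n)).
Proof.
move=> cu; rewrite -fct_sumE.
elim/big_ind: _ => [|f g cf cg|j Pj]; last exact: cu.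
- have -> : series (0 : nat -> R) = fun=> 0.
    by apply/funext => n; rewrite /series/= big1.
  exact: is_cvg_cst.
- exact: is_cvg_seriesD.
Qed.

Lemma series_tail_lt (R : realType) (u : nat -> R) (eps : R) :
  (forall n, 0 <= u n) -> cvgn (series u) -> 0 < eps ->
  exists T, forall n, \sum_(T <= s < T + n) u s < eps.
Proof.
move=> u0 /cauchy_cvgP/cauchy_seriesP cu eps0.
have [[P Q] [/= [a _ aP] [b _ bQ]] PQ] := cu _ eps0.
exists (maxn a b) => n.
apply: le_lt_trans (ler_norm _) _.
apply: (PQ (maxn a b, maxn a b + n)%N); split => /=.
  by apply: aP => /=; rewrite leq_maxl.
by apply: bQ => /=; apply: leq_trans (leq_addr _ _); rewrite leq_maxr.
Qed.

(** Comparison test under an eventual inequality. *)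
Lemma series_le_tail_cvg (R : realType) (u v : nat -> R) (T : nat) :
  (forall n, 0 <= u n) -> (forall n, 0 <= v n) ->
  (forall n, (T <= n)%N -> u n <= v n) -> cvgn (series v) -> cvgn (series u).
Proof.
move=> u0 v0 uv cv.
apply/cauchy_cvgP/cauchy_seriesP => e e0.
move/cauchy_cvgP/cauchy_seriesP: cv => /(_ e e0).
move=> [[P Q] [/= PT QT] PQ].
exists ((P `&` [set n | (T <= n)%N])%classic, Q) => /=.
  by split=> //; apply: filterI => //; exact: nbhs_infty_ge.
move=> [n m] [/= [Pn Tn] Qm].
have := PQ (n, m) (conj Pn Qm) => /=; apply: le_lt_trans.
rewrite !ger0_norm ?sumr_ge0//; apply: ler_sum_nat => k /andP[nk _].
by rewrite uv// (leq_trans Tn).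
Qed.

(** * Stochastic products and leaks out of a jet *)

Section jets.
Variables (R : realType) (N : nat).
Implicit Types (A : nat -> 'M[R]_N) (J : jet N) (x : nat -> 'I_N -> R).

Lemma stochastic1 : stochastic (1%:M : 'M[R]_N).
Proof.
split=> [i j|i]; first by rewrite mxE; case: (i == j).
rewrite (bigD1 i)//= big1 ?addr0 ?mxE ?eqxx// => j ji.
by rewrite mxE eq_sym (negbTE ji).
Qed.

Lemma stochastic_mul (B C : 'M[R]_N) :
  stochastic B -> stochastic C -> stochastic (B *m C).
Proof.
move=> [B0 B1] [C0 C1]; split=> [i j|i].
  by rewrite mxE; apply: sumr_ge0 => k _; rewrite mulr_ge0.
under eq_bigr do rewrite mxE.
rewrite exchange_big/= -[RHS](B1 i); apply: eq_bigr => k _.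
by rewrite -mulr_sumr C1 mulr1.
Qed.

(** The weight that the rows indexed by [J t.+1] put, at time [t], on the columns
    outside [J t], hence also on the columns outside any ambient set of [J]. *)
Definition leak A J (t : nat) : R :=
  \sum_(i in J t.+1) \sum_(j in ~: J t) A t i j.

Lemma leak_ge0 A J t : (forall t, stochastic (A t)) -> 0 <= leak A J t.
Proof.
by move=> sA; apply: sumr_ge0 => i _; apply: sumr_ge0 => j _; case: (sA t).
Qed.

Lemma le_leak A J t i j : (forall t, stochastic (A t)) ->
  i \in J t.+1 -> j \notin J t -> A t i j <= leak A J t.
Proof.
move=> sA iJ jJ; have A0 t' i' j' : 0 <= A t' i' j' by case: (sA t').
rewrite /leak (bigD1 i)//= (bigD1 j)/= ?inE//.
rewrite -addrA lerDl addr_ge0// sumr_ge0// => i' _.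
by rewrite sumr_ge0.
Qed.

(** A trajectory [x (n + 1) = A (T + n) x n] of nonnegative vectors that starts
    at least at [1] on [J T] loses on the moving set [J (T + n)] at most the
    total leak: row [i \in J (T + n + 1)] gives mass at least [1 - leak] to
    [J (T + n)], where the bound holds by induction. *)
Lemma jet_tracking A J x (T : nat) :
  (forall t, stochastic (A t)) ->
  (forall n i, x n.+1 i = \sum_j A (T + n)%N i j * x n j) ->
  (forall n i, 0 <= x n i) ->
  (forall i, i \in J T -> 1 <= x 0 i) ->
  forall n i, i \in J (T + n)%N ->
    1 - \sum_(T <= s < T + n) leak A J s <= x n i.
Proof.
move=> sA xS x0 xT; have A0 t i j : 0 <= A t i j by case: (sA t).
elim=> [|n IHn] i; first by rewrite addn0 big_geq// subr0; exact: xT.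
rewrite addnS big_nat_recr ?leq_addr//= => iJ.
set m := \sum_(_ <= _ < _) _ in IHn *.
have m0 : 0 <= m by apply: sumr_ge0 => s _; exact: leak_ge0.
set l := \sum_(j in ~: J (T + n)%N) A (T + n)%N i j.
have l0 : 0 <= l by apply: sumr_ge0.
have lL : l <= leak A J (T + n)%N.
  rewrite /leak (bigD1 i)//= lerDl sumr_ge0// => k _; exact: sumr_ge0.
have lE : \sum_(j in J (T + n)%N) A (T + n)%N i j = 1 - l.
  have [_ /(_ i) <-] := sA (T + n)%N.
  rewrite [X in _ = X - _](bigID (mem (J (T + n)%N)))/= /l.
  by under [X in _ = _ - X]eq_bigl do rewrite inE; rewrite addrK.
rewrite xS (bigID (mem (J (T + n)%N)))/=.
apply: (@le_trans _ _ ((1 - l) * (1 - m))); first by nra.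
rewrite -lE mulr_suml -[leLHS]addr0 lerD//.
  by apply: ler_sum => j jJ; rewrite ler_wpM2l// IHn.
by apply: sumr_ge0 => j _; rewrite mulr_ge0.
Qed.

(** The product [A (T + n - 1) ... A T] of [n] factors: it is the identity for
    [n = 0], and [backward_prod A T (T + n - 1)] otherwise. *)
Definition transition A (T n : nat) : 'M[R]_N :=
  \big[mulmx/1%:M]_(s <- rev (index_iota T (T + n))) A s.

Lemma transition0 A T : transition A T 0 = 1%:M.
Proof. by rewrite /transition addn0 /index_iota subnn big_nil. Qed.

Lemma transitionS A T n :
  transition A T n.+1 = A (T + n)%N *m transition A T n.
Proof.
rewrite /transition /index_iota !addKn -[n.+1]addn1 iotaD rev_cat/=.
by rewrite big_cons.
Qed.

Lemma stochastic_transition A T n :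
  (forall t, stochastic (A t)) -> stochastic (transition A T n).
Proof.
move=> sA; elim: n => [|n IHn]; first by rewrite transition0; exact: stochastic1.
by rewrite transitionS; exact: stochastic_mul.
Qed.

Lemma transition_backward_prod A T n :
  transition A T n.+1 = backward_prod A T (T + n).
Proof. by rewrite /transition addnS. Qed.

(** Under class-ergodicity the trajectory started at the indicator of [S]
    converges, so its increments tend to [0]; the index set being finite, they
    do so uniformly. *)
Lemma transition_steps_lt A T (S : {set 'I_N}) (eps : R) :
  class_ergodic A -> 0 < eps ->
  \forall n \near \oo, forall i,
    `|\sum_(j in S) transition A T n.+1 i j
      - \sum_(j in S) transition A T n i j| < eps.
Proof.
move=> /(_ T) cA eps0.
pose f i n := \sum_(j in S) transition A T n i j.
have cf i : cvgn (f i).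
  rewrite /f -fct_sumE; elim/big_ind: _ => [|g h cg ch|j _].
  - exact: is_cvg_cst.
  - exact: is_cvgD.
  - apply/cvg_ex.
    exists ((lim (backward_prod A T t @[t --> \oo])) i j).
    rewrite -cvg_shiftS.
    have -> : [sequence transition A T n.+1 i j]_n
        = [sequence backward_prod A T (n + T)%N i j]_n.
      by apply/funext => n; rewrite /= transition_backward_prod addnC.
    rewrite (cvg_shiftn T (fun t => backward_prod A T t i j)).
    exact: cvg_comp cA (@coord_continuous _ _ _ i j _).
apply: filter_forall => i.
apply: cvgr0_norm_lt => //.
have fl : f i n @[n --> \oo] --> limn (f i) := cf i.
have fSl : f i n.+1 @[n --> \oo] --> limn (f i) by rewrite (cvg_shiftS (f i)).
have := cvgB fSl fl.
rewrite subrr; exact.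
Qed.

(** * Jets in an island *)

Lemma leak_split A J (I : {set 'I_N}) t :
  jet_in I J ->
  leak A J t = \sum_(i in J t.+1) \sum_(j in jet_compl I J t) A t i j
             + \sum_(i in J t.+1) \sum_(j in ~: I) A t i j.
Proof.
move=> JI; rewrite -big_split/=; apply: eq_bigr => i _.
rewrite (bigID (mem I))/=; congr (_ + _); apply: eq_bigl => j; rewrite !inE.
  by rewrite andbC.
case: (boolP (j \in I)); rewrite ?andbF ?andbT// => jI.
by apply: contra jI; exact: (fintype.subsetP (JI t)).
Qed.

(** The total flow out of a connected component of the infinite flow graph is
    finite. *)
Lemma cvg_series_island_boundary A (I : {set 'I_N}) :
  (forall t, stochastic (A t)) -> island A I ->
  cvgn (series (fun t => \sum_(i in I) \sum_(j in ~: I) A t i j)).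
Proof.
move=> sA [i0 ->]; apply: is_cvg_series_sum => i; rewrite inE => i0i.
apply: is_cvg_series_sum => j; rewrite !inE => i0j.
have A0 t i' j' : 0 <= A t i' j' by case: (sA t).
apply: (@series_le_cvg _ _ (fun t => A t i j + A t j i)) => [t|t|t|] //.
- by rewrite addr_ge0.
- by rewrite lerDl.
apply: is_cvg_series_nneseries => [t|]; first by rewrite addr_ge0.
have ij : i != j by apply: contraNneq i0j => <-.
apply: contra i0j => ijoo; apply: connect_trans i0i (connect1 _).
by rewrite /infinite_flow ij ijoo.
Qed.

Lemma jet_compl_in J (I : {set 'I_N}) : jet_in I (jet_compl I J).
Proof. by move=> t; exact: finset.subsetDl. Qed.

Lemma jet_complK J (I : {set 'I_N}) :
  jet_in I J -> jet_compl I (jet_compl I J) = J.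
Proof.
move=> JI; apply/funext => t.
rewrite /jet_compl finset.setDDr finset.setDv finset.set0U.
by apply/finset.setIidPr.
Qed.

Lemma jet_flowC A (Js Jk : jet N) : jet_flow A Js Jk = jet_flow A Jk Js.
Proof. by apply: eq_eseriesr => t _; rewrite addrC. Qed.

Lemma cvg_series_leak A J (I : {set 'I_N}) :
  (forall t, stochastic (A t)) -> island A I -> jet_in I J ->
  jet_flow A J (jet_compl I J) != +oo%E -> cvgn (series (leak A J)).
Proof.
move=> sA isI JI Joo.
have A0 t i j : 0 <= A t i j by case: (sA t).
pose c t := \sum_(i in J t.+1) \sum_(j in jet_compl I J t) A t i j
          + \sum_(i in jet_compl I J t.+1) \sum_(j in J t) A t i j.
pose b t := \sum_(i in I) \sum_(j in ~: I) A t i j.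
have s0 t (S1 S2 : {set 'I_N}) : 0 <= \sum_(i in S1) \sum_(j in S2) A t i j.
  by apply: sumr_ge0 => i _; exact: sumr_ge0.
have cc : cvgn (series c).
  by apply: is_cvg_series_nneseries => // t; rewrite addr_ge0.
have cb : cvgn (series b) by exact: cvg_series_island_boundary.
apply: (@series_le_cvg _ _ (c \+ b)).
- by move=> t; exact: leak_ge0.
- by move=> t; rewrite addr_ge0 ?addr_ge0 ?s0.
- move=> t; rewrite (@leak_split _ _ I)//= lerD//; first by rewrite lerDl.
  rewrite /b [leRHS](finset.big_setID (J t.+1))/= (finset.setIidPr (JI _)).
  by rewrite lerDl.
- exact: is_cvg_seriesD cc cb.
Qed.

Lemma infinite_flow_sym A : symmetric (infinite_flow A).
Proof.
move=> i j; rewrite /infinite_flow eq_sym; congr (_ && (_ == _)).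
by apply: eq_eseriesr => t _; rewrite addrC.
Qed.

(** This is where class-ergodicity is used. Started at the indicator of [J T],
    with [T] so large that the leaks after [T] total less than [1 / 3], the
    trajectory stays above [2 / 3] on the jet and below [1 / 3] on its complement
    in [I]. A convergent trajectory eventually moves by less than [1 / 3] per
    step, so no index of [I] can then enter or leave the jet. *)
Lemma jet_eventually_constant A J (I : {set 'I_N}) :
  (forall t, stochastic (A t)) -> class_ergodic A -> jet_in I J ->
  cvgn (series (leak A J)) -> cvgn (series (leak A (jet_compl I J))) ->
  exists T, forall t, (T <= t)%N -> J t = J T.
Proof.
move=> sA eA JI cJ cK.
have third : 0 < 3^-1 :> R by rewrite invr_gt0.
have [T tailT] := @series_tail_lt _ _ 3^-1
  (fun t => addr_ge0 (leak_ge0 J t sA) (leak_ge0 (jet_compl I J) t sA))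
  (is_cvg_seriesD cJ cK) third.
have tailE n : \sum_(T <= s < T + n) leak A J s
    + \sum_(T <= s < T + n) leak A (jet_compl I J) s < 3^-1.
  by rewrite -big_split; exact: tailT.
have tail0 J' n : 0 <= \sum_(T <= s < T + n) leak A J' s.
  by apply: sumr_ge0 => s _; exact: leak_ge0.
pose x n i := \sum_(j in J T) transition A T n i j.
have xS n i : x n.+1 i = \sum_k A (T + n)%N i k * x n k.
  rewrite /x transitionS; under eq_bigr do rewrite mxE.
  by rewrite exchange_big; apply: eq_bigr => k _; rewrite mulr_sumr.
have x0 n i : 0 <= x n i.
  by apply: sumr_ge0 => j _; case: (stochastic_transition T n sA).
have x1 n i : x n i <= 1.
  have [t0 /(_ i) <-] := stochastic_transition T n sA.
  by rewrite [leRHS](bigID (mem (J T)))/= lerDl sumr_ge0.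
have lo n i : i \in J (T + n)%N -> 2 / 3 < x n i.
  move=> iJ.
  have xT j : j \in J T -> 1 <= x 0 j.
    move=> jJ; rewrite /x transition0 (bigD1 j)//= mxE eqxx lerDl.
    by apply: sumr_ge0 => k _; rewrite mxE; case: (j == k).
  have := jet_tracking sA xS x0 xT iJ.
  have := tailE n; have := tail0 (jet_compl I J) n; lra.
have hi n i : i \in jet_compl I J (T + n)%N -> x n i < 1 / 3.
  move=> iJ.
  (* The upper bound on [x] is the lower bound on [1 - x], which is again a
     trajectory because the rows sum to [1]. *)
  have yS m j : 1 - x m.+1 j = \sum_k A (T + m)%N j k * (1 - x m k).
    have [_ /(_ j) A1] := sA (T + m)%N.
    under eq_bigr do rewrite mulrBr mulr1.
    by rewrite sumrB A1 xS.
  have y0 m j : 0 <= 1 - x m j by rewrite subr_ge0.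
  have yT j : j \in jet_compl I J T -> 1 <= 1 - x 0 j.
    rewrite inE => /andP[jJ _]; rewrite /x transition0 big1 ?subr0// => k kJ.
    by rewrite mxE; case: eqP kJ jJ => // ->  ->.
  have := jet_tracking sA yS y0 yT iJ.
  have := tailE n; have := tail0 J n; lra.
have [M _ stepM] := transition_steps_lt T (J T) eA third.
exists (T + M)%N => t /subnKC <-.
elim: (t - _)%N => [|n <-]; first by rewrite addn0.
rewrite addnS -addnA -addnS; apply/finset.setP => i.
have step : `|x (M + n).+1 i - x (M + n)%N i| < 3^-1.
  by apply: stepM => /=; exact: leq_addr.
have [iI|iI] := boolP (i \in I); last first.
  have notJ k : (i \in J k) = false.
    by apply: contraNF iI; exact: (fintype.subsetP (JI k)).
  by rewrite !notJ.
have iK k : i \notin J k -> i \in jet_compl I J k by rewrite inE iI andbT.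
move: step; rewrite ltr_distl => /andP[s1 s2].
have [i1|/iK i1] := boolP (i \in J (T + (M + n).+1)%N);
  have [i2|/iK i2] := boolP (i \in J (T + (M + n))%N) => //.
- have := lo _ _ i1; have := hi _ _ i2; lra.
- have := hi _ _ i1; have := lo _ _ i2; lra.
Qed.

(** Once the jet is constant, each entry between it and its complement is
    dominated by the leaks, so no edge of the infinite flow graph crosses. *)
Lemma infinite_flow_leak A J (I : {set 'I_N}) (T : nat) i j :
  (forall t, stochastic (A t)) -> (forall t, (T <= t)%N -> J t = J T) ->
  i \in J T -> j \in jet_compl I J T ->
  cvgn (series (leak A J)) -> cvgn (series (leak A (jet_compl I J))) ->
  ~~ infinite_flow A i j.
Proof.
move=> sA JT iJ jK cJ cK.
have KT t : (T <= t)%N -> jet_compl I J t = jet_compl I J T.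
  by move=> /JT; rewrite /jet_compl => ->.
have A0 t i' j' : 0 <= A t i' j' by case: (sA t).
rewrite negb_and negbK; apply/orP; right.
apply: nneseries_neq_pinfty.
apply: (@series_le_tail_cvg _ _ (leak A J \+ leak A (jet_compl I J)) T).
- by move=> t; rewrite addr_ge0.
- by move=> t; rewrite addr_ge0// leak_ge0.
- move=> t Tt; have Tt1 : (T <= t.+1)%N by exact: leqW.
  apply: lerD; apply: le_leak => //; rewrite ?JT ?KT//.
    by move: jK; rewrite inE => /andP[].
  by rewrite inE iJ.
- exact: is_cvg_seriesD.
Qed.

End jets.

Theorem theorem1 (R : realType) (N : nat) (A : nat -> 'M[R]_N)
  (A_stochastic : forall t : nat, stochastic (A t)) :
  class_ergodic A ->
  forall I : {set 'I_N}, island A I -> infinite_jet_flow A I.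
Proof.
move=> ergA I isI J JI propJ; apply/eqP; apply: contraT => Joo.
have cJ := cvg_series_leak A_stochastic isI JI Joo.
have cK : cvgn (series (leak A (jet_compl I J))).
  apply: (cvg_series_leak A_stochastic isI); first exact: jet_compl_in.
  by rewrite jet_complK// jet_flowC.
have [T JT] := jet_eventually_constant A_stochastic ergA JI cJ cK.
have [/eqP /set0Pn[i iJ] /properP[_ [j jI jJ]]] := propJ T.
have [i0 I_def] := isI.
have symA := sym_connect_sym (infinite_flow_sym A).
(* No edge leaves [J T], so it is a union of connected components. *)
have closedJ : closed_mem (infinite_flow A) (mem (J T)).
  apply: (intro_closed symA) => k l kl kJ; apply: contraT => lJ.
  have kI : k \in I by apply: (fintype.subsetP (JI T)).
  have lI : l \in I.
    by move: kI; rewrite I_def !inE => /connect_trans; apply; exact: connect1.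
  have lK : l \in jet_compl I J T by rewrite inE lJ lI.
  by have := infinite_flow_leak A_stochastic JT kJ lK cJ cK; rewrite kl.
have ij : connect (infinite_flow A) i j.
  have iI : i \in I by apply: (fintype.subsetP (JI T)).
  move: iI jI; rewrite I_def !inE symA => ii0; exact: connect_trans.
by have := closed_connect closedJ ij; rewrite /= iJ (negbTE jJ).
Qed.
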